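(* Let $\gamma:G\to\mathtt{J}^m(G;W)$ be a smooth section (i.e. $\pi_G\circ\gamma=\mathrm{id}_G$, where $\pi_G:\mathtt{J}^m(G;W)=G\times\mathtt{HD}^{\le m}(\mathfrak g;W)\to G$ is the projection). The following statements are equivalent: (i) there exists a smooth $f:G\to W$ such that $\gamma=\mathtt{J}^mf$; (ii) $\gamma^*\omega^\ell|_{\mathscr H_G}=0$ for every $0\le\ell\le m-1$; (iii) $d\gamma(\mathscr H_G)\subset\mathscr H^m$.
   Context: $G$ is a stratified (Carnot) group of step $s\ge1$: a connected, simply connected Lie group with Lie algebra $\mathfrak g=V_1\oplus\dots\oplus V_s$, $V_s\neq\{0\}$, $[V_1,V_j]=V_{j+1}$ for $1\le j<s$, $[V_i,V_j]=0$ for $i+j>s$. $W$ is a finite-dimensional real vector space. For $v\in\mathfrak g$, $\tilde v$ is the left-invariant vector field on $G$ with $\tilde v(e)=v$. $\mathscr H_G\subset TG$ is the left-invariant subbundle spanned by $\tilde v$, $v\in V_1$; $\Pi_1:\mathfrak g\to V_1$ is the projection along the other layers; $L_a$ is left translation by $a$. For $f\in C^\infty(G;W)$, $k\ge 0$ and $p\in G$, $A^k_{f,p}$ is the $k$-multilinear map $V_1^k\to W$, $A^k_{f,p}(v_1,\dots,v_k)=\tilde v_k\cdots\tilde v_1f(p)$ (with $A^0_{f,p}=f(p)$). $\mathtt{HD}^k(\mathfrak g;W)$ is the vector space of all such $k$-multilinear maps, $\mathtt{HD}^0(\mathfrak g;W)=W$, and $\mathtt{HD}^{\le m}(\mathfrak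 g;W)=\bigoplus_{k=0}^m\mathtt{HD}^k(\mathfrak g;W)$, with components denoted $A^k$; $A^{\le m}_{f,p}=\sum_{k=0}^mA^k_{f,p}$. For $v\in V_1$ and $A\in\mathtt{HD}^k$, $k\ge1$, $v\lrcorner A\in\mathtt{HD}^{k-1}$ is $(v\lrcorner A)(v_1,\dots,v_{k-1})=A(v_1,\dots,v_{k-1},v)$. $\mathtt{J}^m(G;W)=G\times\mathtt{HD}^{\le m}(\mathfrak g;W)$, with $T_{(a,A)}\mathtt{J}^m(G;W)=T_aG\times\mathtt{HD}^{\le m}(\mathfrak g;W)$. The $m$-jet of $f$ is the section $\mathtt{J}^mf(p)=(p,A^{\le m}_{f,p})$. For $0\le\ell<m$, $\omega^\ell$ is the $\mathtt{HD}^\ell(\mathfrak g;W)$-valued 1-form on $\mathtt{J}^m(G;W)$, $\omega^\ell(a,A)(x,X)=X^\ell-\Pi_1(dL_a^{-1}x)\lrcorner A^{\ell+1}$. The Cartan distribution is \[ \mathscr H^m_{(a,A)}=\{(\tilde v(a),B): v\in V_1,\ B\in\mathtt{HD}^{\le m}(\mathfrak g;W),\ B^\ell=v\lrcorner A^{\ell+1}\ \text{for } 0\le\ell\le m-1\}. \] *)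

(* Defs.v *)
From HB Require Import structures.
From mathcomp Require Import all_boot all_order all_algebra.
From mathcomp Require Import all_classical all_reals all_analysis.

Set Implicit Arguments.
Unset Strict Implicit.
Unset Printing Implicit Defensive.

Import Order.TTheory GRing.Theory Num.Theory.
Import numFieldNormedType.Exports.
Local Open Scope classical_set_scope.
Local Open Scope ring_scope.

(* Any norm on a finite-dimensional real vector space yields the same notions
   of smoothness and derivative; the norm only gives access to 'd. *)
#[short(type="finDimNormedModType")]
HB.structure Definition FinDimNormedModule (R : numFieldType) :=
  {W of NormedModule R W & Vector R W}.

(* No compatibility is built in; see is_lie_group. *)
#[short(type="preTopologicalGroupType")]
HB.structure Definition PreTopologicalGroup := {G of Topological G & Group G}.

Definition iter_derive (R : realType) (E F : normedModType R)
    (vs : seq E) (f : E -> F) : E -> F :=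
  foldr (fun v g => 'D_v g) f vs.

(* Used only for open U: f is infinitely differentiable at the points of U. *)
Definition smooth_on (R : realType) (E F : normedModType R)
    (U : set E) (f : E -> F) : Prop :=
  forall (vs : seq E) (x : E), U x -> differentiable (iter_derive vs f) x.

(* The values of cmap outside cdom and of cinv outside ccod are irrelevant. *)
Record chart (R : realType) (E : normedModType R) (M : topologicalType) :=
  Chart { cdom : set M; ccod : set E; cmap : M -> E; cinv : E -> M }.

Record is_chart (R : realType) (E : normedModType R) (M : topologicalType)
    (c : chart E M) : Prop := {
  chart_open_dom : open (cdom c);
  chart_open_cod : open (ccod c);
  chart_map_cod : forall p, cdom c p -> ccod c (cmap c p);
  chart_inv_dom : forall x, ccod c x -> cdom c (cinv c x);
  chart_mapK : forall p, cdom c p -> cinv c (cmap c p) = p;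
  chart_invK : forall x, ccod c x -> cmap c (cinv c x) = x;
  chart_map_cts : {within cdom c, continuous (cmap c)};
  chart_inv_cts : {within ccod c, continuous (cinv c)} }.

(* An atlas is given with a preferred chart around each point p, which is used
   to identify the tangent space at p with the model space E. *)
Definition atlas (R : realType) (E : normedModType R) (M : topologicalType) :=
  M -> chart E M.

Record is_manifold (R : realType) (E : normedModType R) (M : topologicalType)
    (A : atlas E M) : Prop := {
  mfd_hausdorff : hausdorff_space M;
  mfd_second_countable : @second_countable M;
  mfd_chart : forall p, is_chart (A p);
  mfd_center : forall p, cdom (A p) p;
  mfd_transition : forall p q,
    smooth_on (ccod (A p) `&` (cinv (A p) @^-1` cdom (A q)))
              (cmap (A q) \o cinv (A p)) }.

Definition vec_atlas (R : realType) (E : normedModType R) : atlas E E :=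
  fun=> Chart setT setT id id.
Arguments vec_atlas {R} E _.

Definition prod_atlas (R : realType) (E F : normedModType R)
    (M N : topologicalType) (A : atlas E M) (B : atlas F N) :
    atlas (E * F)%type (M * N)%type :=
  fun pq => Chart (cdom (A pq.1) `*` cdom (B pq.2))
                  (ccod (A pq.1) `*` ccod (B pq.2))
                  (fun z => (cmap (A pq.1) z.1, cmap (B pq.2) z.2))
                  (fun z => (cinv (A pq.1) z.1, cinv (B pq.2) z.2)).

Definition smooth_map (R : realType) (E F : normedModType R)
    (M N : topologicalType) (A : atlas E M) (B : atlas F N) (f : M -> N) :
    Prop :=
  continuous f /\
  forall p q, smooth_on (ccod (A p) `&` ((f \o cinv (A p)) @^-1` cdom (B q)))
                        (cmap (B q) \o f \o cinv (A p)).

(* df_p : T_p M -> T_(f p) N, read in the preferred charts at p and f p. *)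
Definition tangent_map (R : realType) (E F : normedModType R)
    (M N : topologicalType) (A : atlas E M) (B : atlas F N) (f : M -> N)
    (p : M) (x : E) : F :=
  'd (cmap (B (f p)) \o f \o cinv (A p)) (cmap (A p) p) x.

Definition path_connected (R : realType) (T : topologicalType) : Prop :=
  forall x y : T, exists c : R -> T,
    [/\ {within `[0, 1], continuous c}, c 0 = x & c 1 = y].

Definition simply_connected (R : realType) (T : topologicalType) : Prop :=
  path_connected R T /\
  forall c : R -> T, {within `[0, 1], continuous c} -> c 0 = c 1 ->
  exists H : R * R -> T,
    [/\ {within `[0, 1] `*` `[0, 1], continuous H},
        forall t, t \in `[0, 1] -> H (0, t) = c t,
        forall t, t \in `[0, 1] -> H (1, t) = c 0 &
        forall u, u \in `[0, 1] -> H (u, 0) = c 0 /\ H (u, 1) = c 0].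

Section LieGroup.
Context {R : realType} {n : nat} {G : preTopologicalGroupType}.
Variable A : atlas 'rV[R]_n G.

Definition is_lie_group : Prop :=
  [/\ is_manifold A,
      smooth_map (prod_atlas A A) A (fun z : G * G => (z.1 * z.2)%g)
    & smooth_map A A (fun p : G => (p^-1)%g)].

(* The Lie algebra is T_e G, i.e. 'rV[R]_n through the preferred chart at e;
   left_field v is the left-invariant vector field q |-> d(L_q)_e v. *)
Definition left_field (v : 'rV[R]_n) (q : G) : 'rV[R]_n :=
  tangent_map A A (fun x : G => (q * x)%g) 1%g v.

Definition field_derive (F : normedModType R) (X : G -> 'rV[R]_n) (f : G -> F) :
    G -> F :=
  fun q => tangent_map A (vec_atlas F) f q (X q).

(* The value at e of the commutator of two left-invariant vector fields. It is
   read off from its action on the preferred chart at e, whose differential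
   at e is the identification of T_e G with 'rV[R]_n. *)
Definition lie_bracket (v w : 'rV[R]_n) : 'rV[R]_n :=
  let phi := cmap (A 1%g) in
  field_derive (left_field v) (field_derive (left_field w) phi) 1%g
  - field_derive (left_field w) (field_derive (left_field v) phi) 1%g.

Definition is_span (S : set 'rV[R]_n) (U : {vspace 'rV[R]_n}) : Prop :=
  (forall x, S x -> x \in U) /\
  forall U' : {vspace 'rV[R]_n}, (forall x, S x -> x \in U') -> (U <= U')%VS.

(* The layers are V 1, ..., V s; other values of V are irrelevant. *)
Record is_stratification (s : nat) (V : nat -> {vspace 'rV[R]_n}) : Prop := {
  strat_step : (1 <= s)%N;
  strat_sum : (\sum_(i < s) V i.+1)%VS = fullv;
  strat_direct : directv (\sum_(i < s) V i.+1)%VS;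
  strat_last : V s != 0%VS;
  strat_bracket : forall j, (1 <= j < s)%N ->
    is_span [set x | exists v w,
               [/\ v \in V 1, w \in V j & x = lie_bracket v w]] (V j.+1);
  strat_nilpotent : forall i j, (1 <= i <= s)%N -> (1 <= j <= s)%N ->
    (s < i + j)%N -> forall v w, v \in V i -> w \in V j ->
    lie_bracket v w = 0 }.

Record is_carnot_group (s : nat) (V : nat -> {vspace 'rV[R]_n}) : Prop := {
  carnot_lie : is_lie_group;
  carnot_connected : connected [set: G];
  carnot_simply_connected : simply_connected R G;
  carnot_stratified : is_stratification s V }.

End LieGroup.

Section Jets.
Context {R : realType} {n : nat} {G : preTopologicalGroupType}.
Variables (A : atlas 'rV[R]_n G) (s : nat) (V : nat -> {vspace 'rV[R]_n}).
Variable W : finDimNormedModType R.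

Definition smooth_fun (f : G -> W) : Prop := smooth_map A (vec_atlas W) f.

Definition horizontal_bundle (p : G) : set 'rV[R]_n :=
  [set x | exists2 v, v \in V 1 & x = left_field A v p].

(* Projection onto V 1 along V 2 + ... + V s. *)
Definition Pi1 (x : 'rV[R]_n) : subvs_of (V 1) :=
  vsproj (V 1) (daddv_pi (V 1) (\sum_(i < s.-1) V i.+2)%VS x).

Definition hmap (k : nat) := k.-tuple (subvs_of (V 1)) -> W.

Definition hderiv (f : G -> W) (p : G) (k : nat) : hmap k :=
  fun vs => foldl (fun g v => field_derive A (left_field A (vsval v)) g) f vs p.
Arguments hderiv f p k _ : clear implicits.

(* Not all k-multilinear maps: those of the form A^k_{f,p}. Each of them is
   multilinear, since f is smooth, and by left translation the point p may be
   fixed, so that they form a vector space. *)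
Definition HD (k : nat) : set (hmap k) :=
  [set B | exists f p, smooth_fun f /\ B = hderiv f p k].

Definition hook (k : nat) (v : subvs_of (V 1)) (B : hmap k.+1) : hmap k :=
  fun vs => B [tuple of rcons vs v].

Definition hmaps (m : nat) := forall k : 'I_m.+1, hmap k.

Definition HDle (m : nat) : set (hmaps m) := [set B | forall k, HD (B k)].

Definition jet_space (m : nat) : set (G * hmaps m) := [set z | HDle z.2].

(* For l < m, lift ord0 l : 'I_m.+1 has value l.+1 (by conversion). *)
Definition jlow (m : nat) (B : hmaps m) (l : 'I_m) : hmap l :=
  B (widen_ord (leqnSn m) l).
Arguments jlow {m} B l _.

Definition jhigh (m : nat) (B : hmaps m) (l : 'I_m) : hmap l.+1 :=
  B (lift ord0 l).
Arguments jhigh {m} B l _.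

Definition jet (m : nat) (f : G -> W) (p : G) : G * hmaps m :=
  (p, fun k : 'I_m.+1 => hderiv f p k).

(* HD k is a finite-dimensional space of W-valued functions, so its linear
   forms are generated by those factoring through evaluations: smoothness and
   derivatives of maps into it may be taken pointwise. *)
Definition jet_smooth (m : nat) (gamma : G -> G * hmaps m) : Prop :=
  smooth_map A A (fst \o gamma) /\
  forall (k : 'I_m.+1) vs, smooth_fun (fun q => (gamma q).2 k vs).

Definition jet_tangent_map (m : nat) (gamma : G -> G * hmaps m) (p : G)
    (x : 'rV[R]_n) : 'rV[R]_n * hmaps m :=
  (tangent_map A A (fst \o gamma) p x,
   fun k vs => tangent_map A (vec_atlas W) (fun q => (gamma q).2 k vs) p x).

Definition omega (m : nat) (l : 'I_m) (z : G * hmaps m)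
    (x : 'rV[R]_n * hmaps m) : hmap l :=
  fun vs => jlow x.2 l vs
    - hook (Pi1 (tangent_map A A (fun q : G => (z.1^-1 * q)%g) z.1 x.1))
           (jhigh z.2 l) vs.
Arguments omega {m} l z x _.

Definition pullback_omega (m : nat) (l : 'I_m) (gamma : G -> G * hmaps m)
    (p : G) (x : 'rV[R]_n) : hmap l :=
  omega l (gamma p) (jet_tangent_map gamma p x).

Definition cartan_distribution (m : nat) (z : G * hmaps m) :
    set ('rV[R]_n * hmaps m) :=
  [set x | exists v : subvs_of (V 1),
     [/\ x.1 = left_field A (vsval v) z.1, HDle x.2 &
         forall l : 'I_m, jlow x.2 l = hook v (jhigh z.2 l)]].

End Jets.

Arguments jet {R n G} A V {W} m f p.
Arguments pullback_omega {R n G} A s {V W m} l gamma p x _.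

(* Main.v *)
(**
If [gamma] is the jet of [f], then (ii) holds because [A^(l+1)] is obtained from
[A^l] by one more horizontal derivative. Conversely, (ii) says that the horizontal
derivatives of the component [gamma^l] are given by [gamma^(l+1)], so by induction
on [l] all the components are the horizontal derivatives of [f = gamma^0].

Conditions (ii) and (iii) differ only in that (iii) also requires the derivatives
of the components [gamma^k] to take values in [HD k]. This holds for every smooth
section: [HD k] is a vector space (by left translation, all jets can be taken at
the identity), its elements are determined by their values on finitely many
tuples, and a finite-dimensional subspace contains the derivatives of the maps
with values in it.
*)
Require Import Defs.
From HB Require Import structures.
From mathcomp Require Import all_boot all_order all_algebra.
From mathcomp Require Import all_classical all_reals all_analysis.

Set Implicit Arguments.
Unset Strict Implicit.
Unset Printing Implicit Defensive.

Import Order.TTheory GRing.Theory Num.Theory.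
Import numFieldNormedType.Exports.
Local Open Scope classical_set_scope.
Local Open Scope ring_scope.

(** * Calculus in normed spaces *)

(** The first-order expansion at [x] involves only values near [x], so [g] inherits that of [f], and
    uniqueness of the differential identifies the two. *)
Lemma near_eq_diff (R : numFieldType) (E F : normedModType R) (f g : E -> F)
    (x : E) :
  (\near x, f x = g x) -> differentiable f x ->
  differentiable g x /\ 'd g x = 'd f x :> (E -> F).
Proof.
move=> fg df; have [cdf fE] := (diff_locallyP x f).1 df.
have gE : g \o shift x = cst (g x) + 'd f x +o_ 0 id.
  apply/eqaddoP => e e0; move/eqaddoP : (fE) => /(_ e e0) fP.
  have fg0 : \forall h \near 0, f (h + x) = g (h + x).
    by move: fg; rewrite (near_shift 0) /=; apply: filterS => h /=; rewrite subr0.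
  near=> h.
  have <- : (f \o shift x - (cst (f x) + 'd f x)) h =
            (g \o shift x - (cst (g x) + 'd f x)) h.
    rewrite !fctE /= -(nbhs_singleton fg); congr (_ - _).
    by near: h.
  by near: h.
have dE := diff_unique cdf gE.
by split=> //; apply/diff_locallyP; rewrite dE.
Unshelve. all: by end_near. Qed.

Lemma diff_pairl (R : numFieldType) (E F : normedModType R) (a : E) (x v : F) :
  differentiable (fun y : F => (a, y)) x /\
  'd (fun y : F => (a, y)) x v = (0, v).
Proof.
split; first exact: (differentiable_pair (differentiable_cst a x)).
by rewrite (diff_pair (f := cst a) (g := id)) // diff_cst diff_val //.
Qed.

Lemma diff_pairr (R : numFieldType) (E F : normedModType R) (b : F) (x v : E) :
  differentiable (fun y : E => (y, b)) x /\
  'd (fun y : E => (y, b)) x v = (v, 0).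
Proof.
split; first exact: (differentiable_pair (g := cst b)).
by rewrite (diff_pair (f := id) (g := cst b)) // diff_cst diff_val //.
Qed.

Lemma scaler_is_bilinear (R : numFieldType) (W : normedModType R) :
  bilinear_for
    (GRing.Scale.Law.clone _ _ *:%R _) (GRing.Scale.Law.clone _ _ *:%R _)
    (fun (a : R^o) (w : W) => a *: w).
Proof.
split=> [w a u v|u a v w] /=; first by rewrite scalerDl scalerA.
by rewrite scalerDr !scalerA mulrC.
Qed.

(** Leibniz rule: the product is the pair [(r, w)] followed by scaling, a continuous bilinear
    map. *)
Lemma diff_scale (R : numFieldType) (E W : normedModType R) (r : E -> R^o)
    (w : E -> W) (x : E) : differentiable r x -> differentiable w x ->
  differentiable (fun y => r y *: w y) x /\
  forall v, 'd (fun y => r y *: w y) x v = r x *: 'd w x v + 'd r x v *: w x.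
Proof.
move=> dr dw.
pose bM := bilinear_isBilinear.Build R _ _ _ _ _ _ (@scaler_is_bilinear R W).
pose b : {bilinear R^o -> W -> W} := HB.pack (fun (a : R^o) (w : W) => a *: w) bM.
have bc : continuous (fun p => b p.1 p.2) by exact: scale_continuous.
have dp := differentiable_pair dr dw.
have -> : (fun y => r y *: w y) = (fun p => b p.1 p.2) \o (fun y => (r y, w y)).
  by [].
split; first by apply: differentiable_comp => //; exact: differentiable_bilin.
move=> v; rewrite diff_comp //; last exact: differentiable_bilin.
by rewrite /= (diff_bilin (f := b) _ bc) diff_pair.
Qed.

(* [Ck k U f] is only meaningful for open [U]: the derivatives at the points of
   [U] are those of the total function [f]. *)
Fixpoint Ck (R : realType) (E F : normedModType R) (k : nat) (U : set E)
    (f : E -> F) : Prop :=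
  (forall x, U x -> differentiable f x) /\
  (if k is k'.+1 then forall v, Ck k' U ('D_v f) else True).

(** * Functions of class C^k *)

Section Ck_theory.
Context {R : realType}.
Implicit Types (E F : normedModType R) (k : nat).

Lemma Ck_differentiable E F k (U : set E) (f : E -> F) x :
  Ck k U f -> U x -> differentiable f x.
Proof. by case: k => [|k] [df _]; apply: df. Qed.

(** [Ck] peels off the innermost derivative, that is the last entry of [vs]; hence the induction
    from the end of the list. *)
Lemma smooth_onP E F (U : set E) (f : E -> F) :
  smooth_on U f <-> forall k, Ck k U f.
Proof.
have iter_rcons (vs : seq E) v (g : E -> F) :
    iter_derive (rcons vs v) g = iter_derive vs ('D_v g).
  by rewrite /iter_derive -cats1 foldr_cat.
split=> [sf k|Cf vs x Ux].
  elim: k f sf => [|k IH] f sf; split=> //;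
    try by move=> x Ux; exact: (sf [::] x Ux).
  by move=> v; apply: IH => vs x Ux; rewrite -iter_rcons; apply: sf.
have := Cf (size vs); elim/last_ind: vs f {Cf} => [|vs v IH] f.
  by move=> Cf; exact: Ck_differentiable Cf Ux.
by rewrite size_rcons iter_rcons => -[_ /(_ v)]; apply: IH.
Qed.

Lemma CkS E F k (U : set E) (f : E -> F) : Ck k.+1 U f -> Ck k U f.
Proof.
elim: k f => [|k IH] f [df Df]; split=> // v.
by apply: IH; apply: Df.
Qed.

Lemma Ck_sub E F k (U U' : set E) (f : E -> F) :
  U' `<=` U -> Ck k U f -> Ck k U' f.
Proof.
move=> UU; elim: k f => [|k IH] f [df Df]; split=> //.
- by move=> x /UU/df.
- by move=> x /UU/df.
- by move=> v; apply: IH; exact: Df.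
Qed.

(** [Ck] is a condition point by point on the derivatives of the total function, so containing [x]
    is all that is asked of [U']. *)
Lemma Ck_local E F k (U : set E) (f : E -> F) :
  (forall x, U x -> exists2 U', U' x & Ck k U' f) -> Ck k U f.
Proof.
elim: k f => [|k IH] f loc; split=> //.
- by move=> x /loc[U' U'x [df _]]; exact: df.
- by move=> x /loc[U' U'x [df _]]; exact: df.
- by move=> v; apply: IH => x /loc[U' U'x [_ Df]]; exists U' => //; exact: Df.
Qed.

Lemma eq_on_diff E F (U : set E) (f g : E -> F) x : open U ->
  (forall y, U y -> f y = g y) -> U x -> differentiable f x ->
  differentiable g x /\ 'd g x = 'd f x :> (E -> F).
Proof.
move=> oU fg Ux; apply: near_eq_diff.
by near do apply: fg; exact: open_nbhs_nbhs.
Unshelve. all: by end_near. Qed.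

Lemma eq_on_derive E F (U : set E) (f g : E -> F) x v : open U ->
  (forall y, U y -> f y = g y) -> U x -> 'D_v f x = 'D_v g x.
Proof.
move=> oU fg Ux; apply: near_eq_derive.
by near do apply: fg; exact: open_nbhs_nbhs.
Unshelve. all: by end_near. Qed.

Lemma eq_Ck E F k (U : set E) (f g : E -> F) : open U ->
  (forall x, U x -> f x = g x) -> Ck k U f -> Ck k U g.
Proof.
move=> oU; elim: k f g => [|k IH] f g fg [df Df]; split=> //.
- by move=> x Ux; have [] := eq_on_diff oU fg Ux (df x Ux).
- by move=> x Ux; have [] := eq_on_diff oU fg Ux (df x Ux).
- by move=> v; apply: IH (Df v) => x; exact: eq_on_derive.
Qed.

Lemma Ck_cst E F k (U : set E) (c : F) : Ck k U (cst c).
Proof.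
elim: k c => [|k IH] c; split=> // v.
have -> : 'D_v (cst c) = cst (0 : F).
  by apply/funext => x; rewrite derive_cst.
exact: IH.
Qed.

Lemma CkD E F k (U : set E) (f g : E -> F) : open U ->
  Ck k U f -> Ck k U g -> Ck k U (fun x => f x + g x).
Proof.
move=> oU; elim: k f g => [|k IH] f g [df Df] [dg Dg]; split=> //.
- by move=> x Ux; apply: differentiableD; [exact: df|exact: dg].
- by move=> x Ux; apply: differentiableD; [exact: df|exact: dg].
- move=> v; apply: (eq_Ck oU _ (IH _ _ (Df v) (Dg v))) => x Ux.
  by rewrite -deriveD //; apply: diff_derivable; [exact: df|exact: dg].
Qed.

Lemma Ck_sum E F k (U : set E) (I : Type) (r : seq I) (f : I -> E -> F) :
  open U -> (forall i, Ck k U (f i)) -> Ck k U (fun x => \sum_(i <- r) f i x).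
Proof.
move=> oU Cf; elim: r => [|i r IH].
  under [X in Ck _ _ X]eq_fun do rewrite big_nil.
  exact: Ck_cst.
under [X in Ck _ _ X]eq_fun do rewrite big_cons.
exact: CkD.
Qed.

Lemma Ck_linear E F (F' : normedModType R) k (U : set E) (L : {linear F -> F'})
    (f : E -> F) :
  open U -> continuous L -> Ck k U f -> Ck k U (L \o f).
Proof.
move=> oU cL.
have dL (g : E -> F) x : differentiable g x -> differentiable (L \o g) x.
  by move=> dg; apply: differentiable_comp => //; exact: linear_differentiable.
elim: k f => [|k IH] f [df Df]; split=> //; try by move=> x /df/dL.
move=> v; apply: (eq_Ck oU _ (IH _ (Df v))) => x Ux.
rewrite /= !deriveE; [|exact/dL/df|exact: df].
rewrite (diff_comp (f := f) (g := L));
  [|exact: df|exact: linear_differentiable].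
by rewrite /= diff_lin.
Qed.

Lemma Ck_scale E F k (U : set E) (r : E -> R^o) (f : E -> F) : open U ->
  Ck k U r -> Ck k U f -> Ck k U (fun x => r x *: f x).
Proof.
move=> oU; elim: k r f => [|k IH] r f Cr Cf; split=> //.
- move=> x Ux.
  by have [] := diff_scale (Ck_differentiable Cr Ux) (Ck_differentiable Cf Ux).
- move=> x Ux.
  by have [] := diff_scale (Ck_differentiable Cr Ux) (Ck_differentiable Cf Ux).
move=> v.
apply: (@eq_Ck _ _ _ _ (fun x => r x *: 'D_v f x + 'D_v r x *: f x)) => //.
  move=> x Ux.
  have dr := Ck_differentiable Cr Ux; have df := Ck_differentiable Cf Ux.
  have [d E'] := diff_scale dr df.
  by rewrite (deriveE v d) (deriveE v df) (deriveE v dr) E'.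
apply: CkD => //; apply: IH; [exact: CkS|exact: Cf.2|exact: Cr.2|exact: CkS].
Qed.

(** A constant differential makes a derivative of [f \o h] again a derivative of [f] composed with
    the same [h]. This serves for the slices [x |-> (a, x)] and [x |-> (x, b)] of a product. *)
Lemma Ck_comp_affine E E' F k (U : set E') (h : E -> E') (f : E' -> F) :
  open (h @^-1` U) -> (forall x, differentiable h x) ->
  (forall v, exists u, forall x, 'd h x v = u) ->
  Ck k U f -> Ck k (h @^-1` U) (f \o h).
Proof.
move=> oU dh hd; elim: k f => [|k IH] f [df Df]; split=> //.
- by move=> x Ux; apply: differentiable_comp; [exact: dh|exact: df].
- by move=> x Ux; apply: differentiable_comp; [exact: dh|exact: df].
move=> v; have [u hu] := hd v.
apply: (eq_Ck oU _ (IH _ (Df u))) => x Ux.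
rewrite /= !deriveE; [|by apply: differentiable_comp; [exact: dh|exact: df]
  |exact: df].
rewrite (diff_comp (f := h) (g := f)); [|exact: dh|exact: df].
by rewrite /= hu.
Qed.

Lemma linear_rV_sum (F : lmodType R) n (L : {linear 'rV[R]_n -> F}) v :
  L v = \sum_i v ord0 i *: L (delta_mx ord0 i).
Proof.
by rewrite {1}(row_sum_delta v) linear_sum; under eq_bigr do rewrite linearZ.
Qed.

Lemma Ck_coord E n k (U : set E) (f : E -> 'rV[R]_n) i : open U ->
  Ck k U f -> Ck k U (fun x => f x ord0 i : R^o).
Proof.
move=> oU Cf; pose c (M : 'rV[R]_n) : R^o := M ord0 i.
have lc : linear c by move=> a M N; rewrite /c !mxE.
pose cM := GRing.isLinear.Build _ _ _ _ _ lc.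
pose cL : {linear 'rV[R]_n -> R^o} := HB.pack c cM.
by apply: (@Ck_linear _ _ _ _ _ cL) => //; exact: coord_continuous.
Qed.

(** Chain rule in coordinates: the derivative of [f \o h] along [v] is the finite sum [D] of
    products of a coordinate of ['D_v h] with a partial derivative of [f] composed with [h], to
    which the induction hypothesis applies. *)
Lemma Ck_comp E F n k (U : set E) (V : set 'rV[R]_n) (h : E -> 'rV[R]_n)
    (f : 'rV[R]_n -> F) : open U -> (forall x, U x -> V (h x)) ->
  Ck k U h -> Ck k V f -> Ck k U (f \o h).
Proof.
move=> oU hUV.
have dfh k' (g : 'rV[R]_n -> F) x : Ck k' U h -> Ck k' V g -> U x ->
    differentiable (g \o h) x.
  move=> Ch Cg Ux; apply: differentiable_comp.
    exact: Ck_differentiable Ch Ux.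
  by apply: Ck_differentiable Cg _; exact: hUV.
elim: k f => [|k IH] f Ch Cf; split=> //; try by move=> x; exact: dfh Ch Cf.
move=> v; pose D x := \sum_i 'D_v h x ord0 i *: ('D_(delta_mx ord0 i) f \o h) x.
apply: (@eq_Ck _ _ _ _ D) => //.
  move=> x Ux; have dh := Ck_differentiable Ch Ux.
  have df := Ck_differentiable Cf (hUV _ Ux).
  rewrite deriveE; last exact: dfh Ch Cf Ux.
  rewrite (diff_comp (f := h) (g := f)) // /= linear_rV_sum /D.
  apply: eq_bigr => i _.
  by rewrite /= !deriveE.
apply: Ck_sum => // i; apply: Ck_scale => //.
  by apply: (@Ck_coord _ _ _ _ ('D_v h)) => //; exact: Ch.2.
by apply: IH; [exact: CkS|exact: Cf.2].
Qed.

End Ck_theory.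

(** * Finite-dimensional spaces *)

Section Findim.
Import VectorInternalTheory.
Context {R : realType}.

Lemma diff_big_sum (E F : normedModType R) (I : Type) (r : seq I)
    (f : I -> E -> F) x : (forall i, differentiable (f i) x) ->
  differentiable (fun y => \sum_(i <- r) f i y) x /\
  forall v, 'd (fun y => \sum_(i <- r) f i y) x v = \sum_(i <- r) 'd (f i) x v.
Proof.
move=> df; elim: r => [|i r [IHd IHe]].
  under [X in differentiable X _]eq_fun do rewrite big_nil.
  split; first exact: differentiable_cst.
  move=> v; under [X in 'd X _]eq_fun do rewrite big_nil.
  by rewrite big_nil diff_cst.
have dfi := df i.
under [X in differentiable X _]eq_fun do rewrite big_cons.
split; first by apply: differentiableD.
move=> v; under [X in 'd X _]eq_fun do rewrite big_cons.
by rewrite big_cons (diffD dfi IHd) /= -IHe.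
Qed.

Lemma rV_linear_continuous n (F : normedModType R) (L : {linear 'rV[R]_n -> F}) :
  continuous L.
Proof.
move=> x; apply: differentiable_continuous.
have -> : (L : _ -> _) =
    (fun v : 'rV[R]_n => \sum_i v ord0 i *: L (delta_mx ord0 i)).
  by apply/funext => v; rewrite {1}linear_rV_sum.
apply: (proj1 (diff_big_sum _ _)) => i.
apply: (@differentiableZl _ _ _ (fun v : 'rV[R]_n => v ord0 i)).
exact: differentiable_coord.
Qed.

(** The minimum of [|L u|] on the compact unit sphere is positive by injectivity; homogeneity does
    the rest. *)
Lemma rV_injective_linear_lower_bound n (F : normedModType R)
    (L : {linear 'rV[R]_n -> F}) : injective L ->
  exists2 c, 0 < c & forall u, c * `|u| <= `|L u|.
Proof.
move=> injL; pose A := [set u : 'rV[R]_n | `|u| = 1].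
have normalize (u : 'rV[R]_n) : u != 0 -> A (`|u|^-1 *: u).
  move=> u0; rewrite /A /= normrZ normfV normr_id mulVf //.
  by rewrite normr_eq0.
(* If the sphere is empty, every vector is 0 and any constant works. *)
have [A0|A0] := pselect (A !=set0); last first.
  exists 1 => // u; have [->|/normalize Au] := eqVneq u 0.
    by rewrite normr0 mulr0.
  by case: A0; exists (`|u|^-1 *: u).
have cA : compact A.
  apply: bounded_closed_compact.
    by exists 1; split=> // M M1 u /= ->; exact: ltW.
  have -> : A = (fun u : 'rV[R]_n => `|u|) @^-1` [set 1] by [].
  apply: closed_comp; last exact: closed_eq.
  by move=> u _; exact: norm_continuous.
have cL : {within A, continuous (fun u => `|L u|)}.
  apply: continuous_subspaceT => u.
  apply: (@continuous_comp _ _ _ L (fun w => `|w|)).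
    exact: rV_linear_continuous.
  exact: norm_continuous.
have [c cA' cmin] := EVT_min_rV A0 cA cL.
have c1 : `|c| = 1 by move: cA'; rewrite inE.
exists `|L c|.
  rewrite normr_gt0; apply/eqP => Lc0.
  have /injL c0 : L c = L 0 by rewrite Lc0 linear0.
  by move/eqP: c1; rewrite c0 normr0 eq_sym oner_eq0.
move=> u; have [->|u0] := eqVneq u 0; first by rewrite normr0 mulr0.
have := cmin (`|u|^-1 *: u); rewrite inE => /(_ (normalize _ u0)).
rewrite linearZ /= normrZ normfV normr_id mulrC ler_pdivlMr ?normr_gt0 //.
Qed.

(** The lower bound for the isomorphism [f] from row vectors controls the coordinates of [w] by
    [c^-1 * |w|], and [L \o f] is Lipschitz with constant [k]. *)
Lemma findim_linear_continuous (W : finDimNormedModType R) (F : normedModType R)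
    (L : {linear W -> F}) : continuous L.
Proof.
pose f : {linear 'rV[R]_(dim W) -> W} := @r2v R W.
pose g : W -> 'rV[R]_(dim W) := @v2r R W.
have fK : cancel f g := @r2vK R W.
have gK : cancel g f := @v2rK R W.
have [c c0 cP] := rV_injective_linear_lower_bound
  (L := f) (can_inj fK).
have [k k0 kP] := linear_lipschitz (@rV_linear_continuous _ F (L \o f)%FUN).
apply/linear_bounded_continuous/bounded_funP => r.
exists (k * (c^-1 * r)) => w wr.
rewrite -(gK w); apply: (le_trans (kP _)).
rewrite ler_pM2l // ler_pdivlMl //; apply: (le_trans (cP _)).
by rewrite [X in `|X|]gK.
Qed.

(** Take a subspace inside [S] of maximal dimension: adding the line of an element of [S] stays
    inside [S], so that element already belongs to it. *)
Lemma linear_closed_vspace (K : fieldType) (X : vectType K) (S : set X) :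
  S 0 -> (forall a u v, S u -> S v -> S (a *: u + v)) ->
  exists U : {vspace X}, forall x, (x \in U) <-> S x.
Proof.
move=> S0 SL; pose P d := `[< exists2 U : {vspace X},
  \dim U = d & forall x, x \in U -> S x >].
have exP : exists d, P d.
  exists 0%N; apply/asboolP; exists 0%VS; first exact: dimv0.
  by move=> x; rewrite memv0 => /eqP ->.
have ubP d : P d -> (d <= \dim {:X})%N.
  by move=> /asboolP[U <- _]; exact/dimvS/subvf.
have [d /asboolP[U dU US] dmax] := ex_maxnP exP ubP.
exists U => x; split; [exact: US|move=> Sx].
have /dmax : P (\dim (U + <[x]>)).
  apply/asboolP; exists (U + <[x]>)%VS => //.
  move=> _ /memv_addP[u /US Su [_ /vlineP[a ->] ->]].
  by rewrite addrC; exact: SL.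
rewrite -dU => dle.
have /eqP UE : (U == U + <[x]>)%VS by rewrite eqEdim addvSl.
by rewrite UE; apply: (subvP (addvSr U _)); exact: memv_line.
Qed.

(* Finite-dimensional subspaces are closed; since the elements of [S] are fixed
   by a projection, they are even preserved by differentiation. *)
Lemma diff_in_subspace (E : normedModType R) (W : finDimNormedModType R)
    (I : finType) (S : set (I -> W)) (F : E -> I -> W) (x v : E) :
  S (fun=> 0) ->
  (forall a f g, S f -> S g -> S (fun i => a *: f i + g i)) ->
  (\near x, S (F x)) -> (forall i, differentiable (F^~ i) x) ->
  S (fun i => 'd (F^~ i) x v).
Proof.
move=> S0 SL SF dF.
have eqS f g : f =1 g -> S f -> S g by move=> /funext ->.
have [] := @linear_closed_vspace _ {ffun I -> W} [set f | S f].
- by apply: eqS S0 => i; rewrite ffunE.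
- by move=> a f g /= Sf Sg; apply: eqS (SL a _ _ Sf Sg) => i; rewrite !ffunE.
move=> U UE; have S_fix (f : {ffun I -> W}) : S f <-> projv U f = f.
  split=> [Sf|<-]; first by apply/projv_id/UE.
  by apply/(UE (projv U f)); exact: memv_proj.
pose delta j (w : W) : {ffun I -> W} := [ffun k => if k == j then w else 0].
(* The blocks of the projector onto [U]: membership in [S] becomes the linear system
   [f i = \sum_j M i j (f j)], which passes to derivatives since each block is continuous. *)
pose M i j (w : W) : W := projv U (delta j w) i.
have linM i j : linear (M i j).
  move=> a u w; rewrite /M.
  have -> : delta j (a *: u + w) = a *: delta j u + delta j w.
    by apply/ffunP => k; rewrite !ffunE; case: ifP; rewrite ?scaler0 ?addr0.
  by rewrite linearP !ffunE.
have ME (f : I -> W) i : projv U [ffun j => f j] i = \sum_j M i j (f j).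
  have -> : [ffun j => f j] = \sum_j delta j (f j).
    apply/ffunP => k; rewrite ffunE sum_ffunE (bigD1 k) //= ffunE eqxx.
    by rewrite big1 ?addr0 // => j jk; rewrite ffunE eq_sym (negPf jk).
  by rewrite linear_sum sum_ffunE.
have SM (f : I -> W) : S f <-> forall i, f i = \sum_j M i j (f j).
  have fE : f = [ffun j => f j] by apply/funext => j; rewrite ffunE.
  split=> [|fM]; first rewrite {1}fE => /S_fix ffix i.
    by rewrite -ME ffix ffunE.
  rewrite fE; apply/S_fix/ffunP => i.
  by rewrite ME ffunE -fM.
apply/SM => i.
have dM j : differentiable (fun y => M i j (F y j)) x /\
    'd (fun y => M i j (F y j)) x v = M i j ('d (F^~ j) x v).
  pose LM := GRing.isLinear.Build _ _ _ _ _ (linM i j).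
  pose L : {linear W -> W} := HB.pack (M i j) LM.
  have cL : continuous L by exact: findim_linear_continuous.
  have dL y : differentiable L y by exact: linear_differentiable.
  split; first exact: (differentiable_comp (dF j) (dL _)).
  rewrite (_ : (fun y => _) = L \o F^~ j) //.
  rewrite (diff_comp (f := F^~ j) (g := L)); [|exact: dF|exact: dL].
  by have -> := diff_lin (F x j) cL.
have [dS dSE] := diff_big_sum (index_enum I) (fun j => proj1 (dM j)).
have [_ /(congr1 (@^~ v))] : differentiable (F^~ i) x /\
    'd (F^~ i) x = 'd (fun y => \sum_j M i j (F y j)) x :> (E -> W).
  apply: near_eq_diff => //.
  by near=> y; rewrite -(proj1 (SM (F y))) //; near: y.
move=> ->; rewrite dSE; apply: eq_bigr => j _; exact: (proj2 (dM j)).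
Unshelve. all: by end_near. Qed.

End Findim.

(** * Smooth maps between manifolds *)

Section Manifolds.
Context {R : realType}.
Implicit Types (E F : normedModType R) (M N P : topologicalType).

(** Charts around every point: the form under which manifolds, their products and normed spaces are
    treated alike. *)
Definition is_atlas E M (A : atlas E M) : Prop :=
  forall p, is_chart (A p) /\ cdom (A p) p.

Lemma manifold_atlas E M (A : atlas E M) : is_manifold A -> is_atlas A.
Proof. by move=> mA p; split; [exact: mfd_chart|exact: mfd_center]. Qed.

Lemma vec_is_atlas E : is_atlas (vec_atlas E).
Proof.
move=> p; split=> //; split=> //=; try exact: openT;
  by apply: continuous_subspaceT => x; exact: cvg_id.
Qed.

Lemma open_preimage_within (S T : topologicalType) (D : set S) (g : S -> T)
    (B : set T) :
  open D -> {within D, continuous g} -> open B -> open (D `&` g @^-1` B).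
Proof.
move=> oD; rewrite continuous_open_subspace // => /(continuous_inP g oD).
exact.
Qed.

Lemma prod_is_atlas E F M N (A : atlas E M) (B : atlas F N) :
  is_atlas A -> is_atlas B -> is_atlas (prod_atlas A B).
Proof.
move=> hA hB [p q]; have [[oA oA' A1 A2 A3 A4 A5 A6] Ap] := hA p.
have [[oB oB' B1 B2 B3 B4 B5 B6] Bq] := hB q.
have oX (S T : topologicalType) (U : set S) (V : set T) :
    open U -> open V -> open (U `*` V).
  move=> oU oV; rewrite openE => -[x y] [/= Ux Vy].
  by exists (U, V) => //; split; exact: open_nbhs_nbhs.
have cX (S T S' T' : topologicalType) (U : set S) (V : set T) (f : S -> S')
    (g : T -> T') : open U -> open V -> {within U, continuous f} ->
    {within V, continuous g} ->
    {within U `*` V, continuous (fun z => (f z.1, g z.2))}.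
  move=> oU oV; rewrite !continuous_open_subspace //; last exact: oX.
  move=> cf cg [x y]; rewrite inE => -[/= Ux Vy].
  apply: cvg_pair => /=.
    by apply: (cvg_comp fst f cvg_fst); apply: cf; rewrite inE.
  by apply: (cvg_comp snd g cvg_snd); apply: cg; rewrite inE.
split=> //; split=> /=.
- exact: oX.
- exact: oX.
- by move=> [x y] [/= /A1 ? /B1 ?].
- by move=> [x y] [/= /A2 ? /B2 ?].
- by move=> [x y] [/= /A3 -> /B3 ->].
- by move=> [x y] [/= /A4 -> /B4 ->].
- exact: cX.
- exact: cX.
Qed.

(** The expression of [f] in the charts at [p] and [q], where [q] need not be [f p]; [rep_dom] is
    the set on which [smooth_map] asks it to be smooth. *)
Definition rep E F M N (A : atlas E M) (B : atlas F N) p q (f : M -> N) :=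
  cmap (B q) \o f \o cinv (A p).

Definition rep_dom E F M N (A : atlas E M) (B : atlas F N) p q (f : M -> N) :=
  ccod (A p) `&` ((f \o cinv (A p)) @^-1` cdom (B q)).

Lemma open_rep_dom E F M N (A : atlas E M) (B : atlas F N) p q (f : M -> N) :
  is_atlas A -> is_atlas B -> continuous f -> open (rep_dom A B p q f).
Proof.
move=> hA hB cf; have [[_ oA _ _ _ _ _ cA] _] := hA p.
have [[oB _ _ _ _ _ _ _] _] := hB q.
apply: (open_preimage_within (g := cinv (A p)) (B := f @^-1` cdom (B q))) => //.
by apply: open_comp => // x _; exact: cf.
Qed.

Lemma rep_dom_center E F M N (A : atlas E M) (B : atlas F N) (f : M -> N) p :
  is_atlas A -> is_atlas B -> rep_dom A B p (f p) f (cmap (A p) p).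
Proof.
move=> hA hB; have [cA Ap] := hA p; have [_ Bfp] := hB (f p).
by split; [exact: chart_map_cod|rewrite /= (chart_mapK cA)].
Qed.

Lemma smooth_map_Ck E F M N (A : atlas E M) (B : atlas F N) p q (f : M -> N) k :
  smooth_map A B f -> Ck k (rep_dom A B p q f) (rep A B p q f).
Proof. by move=> [_ /(_ p q)/smooth_onP]. Qed.

Lemma rep_comp n E F M N P (A : atlas E M) (B : atlas 'rV[R]_n N)
    (C : atlas F P) (f : M -> N) (g : N -> P) p r q x :
  is_atlas B -> rep_dom A B p r f x -> rep_dom A C p q (g \o f) x ->
  rep A C p q (g \o f) x = (rep B C r q g \o rep A B p r f) x /\
  rep_dom B C r q g (rep A B p r f x).
Proof.
move=> hB [Ux fx] [_ gfx]; have [cB _] := hB r; rewrite /rep /rep_dom /=.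
split; first by rewrite (chart_mapK cB).
by split; [exact: chart_map_cod|rewrite /= (chart_mapK cB)].
Qed.

Lemma smooth_map_comp n E F M N P (A : atlas E M) (B : atlas 'rV[R]_n N)
    (C : atlas F P) (f : M -> N) (g : N -> P) :
  is_atlas A -> is_atlas B -> is_atlas C ->
  smooth_map A B f -> smooth_map B C g -> smooth_map A C (g \o f).
Proof.
move=> hA hB hC sf sg; have [cf _] := sf; have [cg _] := sg.
have cgf : continuous (g \o f).
  by move=> x; apply: continuous_comp; [exact: cf|exact: cg].
split=> // p q; apply/smooth_onP => k; apply: Ck_local => x Ux.
(* The intermediate chart is the preferred one at the image of the point under study; [Ck_local]
   allows it to vary with that point. *)
have [_ Br] := hB (f (cinv (A p) x)); set r := f _ in Br.
exists (rep_dom A B p r f `&` rep_dom A C p q (g \o f)).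
  by split=> //; case: Ux.
have oU := openI (open_rep_dom p r hA hB cf) (open_rep_dom p q hA hC cgf).
apply: (@eq_Ck _ _ _ _ _ (rep B C r q g \o rep A B p r f)) => //.
  by move=> y [fy gfy]; have [] := rep_comp hB fy gfy.
apply: (Ck_comp oU (V := rep_dom B C r q g)).
- by move=> y [fy gfy]; have [] := rep_comp hB fy gfy.
- by apply: Ck_sub (smooth_map_Ck p r k sf); exact: subIsetl.
- exact: smooth_map_Ck.
Qed.

Lemma rep_differentiable E F M N (A : atlas E M) (B : atlas F N) (f : M -> N) p :
  is_atlas A -> is_atlas B -> smooth_map A B f ->
  differentiable (rep A B p (f p) f) (cmap (A p) p).
Proof.
move=> hA hB sf; apply: Ck_differentiable (smooth_map_Ck p (f p) 0 sf) _.
exact: rep_dom_center.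
Qed.

(** The preferred charts at [p], [f p] and [g (f p)] match, so this is the chain rule for the chart
    expressions, which compose near the image of [p]. *)
Lemma tangent_map_comp n E F M N P (A : atlas E M) (B : atlas 'rV[R]_n N)
    (C : atlas F P) (f : M -> N) (g : N -> P) p x :
  is_atlas A -> is_atlas B -> is_atlas C ->
  smooth_map A B f -> smooth_map B C g ->
  tangent_map A C (g \o f) p x =
  tangent_map B C g (f p) (tangent_map A B f p x).
Proof.
move=> hA hB hC sf sg; have [cf _] := sf; have [cg _] := sg.
have cgf : continuous (g \o f).
  by move=> y; apply: continuous_comp; [exact: cf|exact: cg].
have repp : rep A B p (f p) f (cmap (A p) p) = cmap (B (f p)) (f p).
  by rewrite /rep /= (chart_mapK (proj1 (hA p)) (proj2 (hA p))).
have dg : differentiable (rep B C (f p) (g (f p)) g)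
    (rep A B p (f p) f (cmap (A p) p)).
  by rewrite repp; exact: rep_differentiable.
have df := rep_differentiable p hA hB sf.
have oU := openI (open_rep_dom p (f p) hA hB cf)
                 (open_rep_dom p (g (f p)) hA hC cgf).
have [] := @eq_on_diff _ _ _ _ (rep B C (f p) (g (f p)) g \o rep A B p (f p) f)
  (rep A C p (g (f p)) (g \o f)) (cmap (A p) p) oU.
- by move=> y [fy gfy]; have [] := rep_comp hB fy gfy.
- by split; exact: rep_dom_center.
- exact: differentiable_comp.
move=> _ dE; have /(congr1 (@^~ x)) := diff_comp df dg.
rewrite -dE repp; exact.
Qed.

Lemma tangent_map_id E M (A : atlas E M) p x :
  is_atlas A -> tangent_map A A id p x = x.
Proof.
move=> hA; have [cA Ap] := hA p.
have [] := @eq_on_diff _ _ _ (ccod (A p)) id (cmap (A p) \o id \o cinv (A p))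
  (cmap (A p) p).
- exact: chart_open_cod.
- by move=> y Uy; rewrite /= (chart_invK cA).
- exact: chart_map_cod.
- by [].
by move=> _; rewrite /tangent_map => ->; rewrite diff_val.
Qed.

(** Continuity follows from differentiability in charts: near [p], [f] is [f \o cinv (A p)] composed
    with the chart. *)
Lemma smooth_map_vec E F M (A : atlas E M) (f : M -> F) : is_atlas A ->
  smooth_map A (vec_atlas F) f <->
  forall p k, Ck k (ccod (A p)) (f \o cinv (A p)).
Proof.
move=> hA; split=> [sf p k|Cf].
  by apply: Ck_sub (smooth_map_Ck p 0 k sf) => x.
split; last first.
  by move=> p q; apply/smooth_onP => k; apply: Ck_sub (Cf p k) => x [].
move=> p; have [cA Ap] := hA p.
have nA : \forall y \near p, cdom (A p) y.
  by apply: open_nbhs_nbhs; split=> //; exact: chart_open_dom.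
have cm : {for p, continuous (cmap (A p))}.
  have := chart_map_cts cA; rewrite continuous_open_subspace.
    by apply; rewrite inE.
  exact: chart_open_dom.
have cr : {for p, continuous ((f \o cinv (A p)) \o cmap (A p))}.
  apply: continuous_comp => //; apply: differentiable_continuous.
  by apply: Ck_differentiable (Cf p 0) _; exact: chart_map_cod.
have fp : f p = ((f \o cinv (A p)) \o cmap (A p)) p.
  by rewrite /= (chart_mapK cA).
rewrite /continuous_at fp; apply: cvg_trans cr.
apply: near_eq_cvg; near=> y; rewrite /= (chart_mapK cA) //.
by near: y.
Unshelve. all: by end_near. Qed.

End Manifolds.

(** * Left-invariant fields *)

Section LieGroupCalculus.
Context {R : realType} {n : nat} {G : preTopologicalGroupType}.
Variable A : atlas 'rV[R]_n G.
Hypothesis lieA : is_lie_group A.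
Local Open Scope group_scope.

Let hA : is_atlas A. Proof. by have [/manifold_atlas] := lieA. Qed.

Let smooth_mul : smooth_map (prod_atlas A A) A (fun z : G * G => z.1 * z.2).
Proof. by have [] := lieA. Qed.

Let e0 : 'rV[R]_n := cmap (A 1) 1.

(** Left translation is the multiplication restricted to the slice of first coordinate [a]; in
    charts this slice is the affine map [h]. *)
Lemma smooth_left_mul (a : G) : smooth_map A A (fun x => a * x).
Proof.
have [cmul _] := smooth_mul; split.
  move=> x; apply: (@continuous_comp _ _ _ (fun y : G => (a, y))
    (fun z : G * G => z.1 * z.2)); last exact: cmul.
  by apply: cvg_pair; [exact: cvg_cst|exact: cvg_id].
move=> p q; apply/smooth_onP => k.
pose h (x : 'rV[R]_n) := (cmap (A a) a, x).
have [ca Aa] := hA a.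
pose U := rep_dom (prod_atlas A A) A (a, p) q (fun z : G * G => z.1 * z.2).
have oU : open (h @^-1` U).
  apply: open_comp; last by apply: open_rep_dom => //; exact: prod_is_atlas.
  move=> x _; apply: differentiable_continuous.
  by have [] := diff_pairl (cmap (A a) a) x 0%R.
apply: (@Ck_sub _ _ _ _ (h @^-1` U)).
  move=> x [Ux ax]; rewrite /h /U /rep_dom /= (chart_mapK ca Aa).
  by do 2 split=> //; exact: chart_map_cod.
apply: (@eq_Ck _ _ _ _ _ (rep (prod_atlas A A) A (a, p) q
  (fun z : G * G => z.1 * z.2) \o h)) => //.
  by move=> x _; rewrite /rep /h /= (chart_mapK ca Aa).
apply: Ck_comp_affine => //.
- by move=> v; exists (0%R, v) => x; have [] := diff_pairl (cmap (A a) a) x v.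
- exact: smooth_map_Ck.
Qed.

Lemma left_field_translate (a : G) v p :
  tangent_map A A (fun x => a * x) p (left_field A v p) = left_field A v (a * p).
Proof.
rewrite /left_field.
(* The base point is written [p * 1] to match the chain rule for [x |-> a * (p * x)] at the
   identity. *)
have -> : tangent_map A A (fun x => a * x) p =
          tangent_map A A (fun x => a * x) (p * 1) by rewrite mulg1.
have := tangent_map_comp 1 v hA hA hA (smooth_left_mul p) (smooth_left_mul a).
move=> <-; congr (tangent_map A A _ 1 v).
by apply/funext => x; rewrite /= mulgA.
Qed.

Lemma left_field1 v : left_field A v 1 = v.
Proof.
rewrite /left_field (_ : (fun x => 1 * x) = id) ?tangent_map_id //.
by apply/funext => x; rewrite mul1g.
Qed.

(** The Maurer-Cartan form, which occurs in [omega], recovers the generator of a left-invariant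
    field. *)
Lemma left_fieldK v p :
  tangent_map A A (fun x => p^-1 * x) p (left_field A v p) = v.
Proof. by rewrite left_field_translate mulVg left_field1. Qed.

Section Derive.
Variable F : normedModType R.
Implicit Types f g : G -> F.

(** By the chain rule, everything is read in the fixed chart at the identity and [q] becomes a
    parameter. *)
Lemma field_derive_left v f q : smooth_map A (vec_atlas F) f ->
  field_derive A (left_field A v) f q =
  'd (f \o (fun x => q * x) \o cinv (A 1)) e0 v.
Proof.
move=> sf; rewrite /field_derive /left_field.
have -> : tangent_map A (vec_atlas F) f q =
          tangent_map A (vec_atlas F) f (q * 1) by rewrite mulg1.
by have <- := tangent_map_comp 1 v hA hA (@vec_is_atlas _ F)
  (smooth_left_mul q) sf.
Qed.

(* In the chart at [p], the derivative of [f] along the field of [v] is the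
   derivative of [(x, y) |-> f (x * y)] along the constant vector [(0, v)], taken
   at the points [(x, 1)]. *)
Lemma smooth_field_derive v f : smooth_map A (vec_atlas F) f ->
  smooth_map A (vec_atlas F) (field_derive A (left_field A v) f).
Proof.
move=> sf; have hAA := prod_is_atlas hA hA.
have sfm := smooth_map_comp hAA hA (@vec_is_atlas _ F) smooth_mul sf.
apply/(smooth_map_vec _ hA) => p k.
pose Phi := (f \o (fun z : G * G => z.1 * z.2)) \o cinv (prod_atlas A A (p, 1)).
pose U := ccod (prod_atlas A A (p, 1)).
have CPhi j : Ck j U Phi by exact: (proj1 (smooth_map_vec _ hAA) sfm).
pose h (x : 'rV[R]_n) := (x, e0).
have oU : open U by exact: chart_open_cod (proj1 (hAA _)).
have ohU : open (h @^-1` U).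
  apply: open_comp oU => x _; apply: differentiable_continuous.
  by have [] := diff_pairr e0 x 0%R.
have Ue0 : ccod (A 1) e0 by apply: chart_map_cod; have [] := hA 1.
have sub : ccod (A p) `<=` h @^-1` U by move=> x.
apply: (@eq_Ck _ _ _ _ _ ('D_(0%R, v) Phi \o h)).
- exact: chart_open_cod (proj1 (hA p)).
- move=> x Ux; rewrite /= (field_derive_left _ _ sf).
  have dPhi : differentiable Phi (h x).
    by exact: Ck_differentiable (CPhi 0) (sub x Ux).
  have [dp pE] := diff_pairl x e0 v.
  have := diff_comp dp dPhi; rewrite deriveE // => /(congr1 (@^~ v)).
  by rewrite /= pE => <-.
apply: Ck_sub sub _; apply: Ck_comp_affine => //.
- by move=> w; exists (w, 0%R) => x; have [] := diff_pairr e0 x w.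
- exact: (CPhi k.+1).2.
Qed.

Lemma smooth_map_comb a f g : smooth_map A (vec_atlas F) f ->
  smooth_map A (vec_atlas F) g ->
  smooth_map A (vec_atlas F) (fun q => a *: f q + g q)%R.
Proof.
move=> /(smooth_map_vec _ hA) Cf /(smooth_map_vec _ hA) Cg.
apply/(smooth_map_vec _ hA) => p k.
have oU := chart_open_cod (proj1 (hA p)).
apply: CkD (Cg p k) => //.
exact: (Ck_scale oU (Ck_cst k _ (a : R^o)) (Cf p k)).
Qed.

Lemma smooth_map_cst (c : F) : smooth_map A (vec_atlas F) (cst c).
Proof. by apply/(smooth_map_vec _ hA) => p k; exact: Ck_cst. Qed.

Lemma smooth_map_translate a f : smooth_map A (vec_atlas F) f ->
  smooth_map A (vec_atlas F) (f \o (fun x => a * x)).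
Proof.
move=> sf; apply: smooth_map_comp (smooth_left_mul a) sf => //.
exact: vec_is_atlas.
Qed.

Lemma field_derive_comb X a f g : smooth_map A (vec_atlas F) f ->
  smooth_map A (vec_atlas F) g ->
  field_derive A X (fun q => a *: f q + g q)%R =
  (fun q => a *: field_derive A X f q + field_derive A X g q)%R.
Proof.
move=> sf sg; apply/funext => q.
have df := rep_differentiable q hA (@vec_is_atlas _ F) sf.
have dg := rep_differentiable q hA (@vec_is_atlas _ F) sg.
have := diffD (differentiableZ a df) dg; rewrite (diffZ a df).
by move=> /(congr1 (@^~ (X q))).
Qed.

(** Through [field_derive_left], this reduces to associativity: [a * (q * x) = (a * q) * x]. *)
Lemma field_derive_translate v a f : smooth_map A (vec_atlas F) f ->
  field_derive A (left_field A v) (f \o (fun x => a * x)) =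
  field_derive A (left_field A v) f \o (fun x => a * x).
Proof.
move=> sf; apply/funext => q; rewrite /= !field_derive_left //; last first.
  exact: smooth_map_translate.
by congr ('d _ e0 v); apply/funext => x /=; rewrite mulgA.
Qed.

End Derive.

End LieGroupCalculus.

(** * Horizontal jets *)

Section Jets.
Context {R : realType} {n : nat} {G : preTopologicalGroupType}.
Variable A : atlas 'rV[R]_n G.
Hypothesis lieA : is_lie_group A.
Variables (V : nat -> {vspace 'rV[R]_n}) (W : finDimNormedModType R).

Let hA : is_atlas A. Proof. by have [/manifold_atlas] := lieA. Qed.

Definition hfield_derive (v : subvs_of (V 1)) (f : G -> W) : G -> W :=
  field_derive A (left_field A (vsval v)) f.

(** [hderiv] on sequences and as a function of the point, suited to induction; the head of [vs] is
    the derivative taken first. *)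
Definition hderivs (vs : seq (subvs_of (V 1))) (f : G -> W) : G -> W :=
  foldl (fun g v => hfield_derive v g) f vs.

Lemma hderivE f p k (vs : k.-tuple (subvs_of (V 1))) :
  hderiv A f p vs = hderivs vs f p.
Proof. by []. Qed.

Lemma smooth_hfield_derive v f :
  smooth_fun A f -> smooth_fun A (hfield_derive v f).
Proof. exact: smooth_field_derive. Qed.

Lemma smooth_fun_comb a (f g : G -> W) : smooth_fun A f -> smooth_fun A g ->
  smooth_fun A (fun q => a *: f q + g q).
Proof. by move=> sf sg; have := smooth_map_comb lieA a sf sg. Qed.

Lemma hderivs_comb vs a f g : smooth_fun A f -> smooth_fun A g ->
  hderivs vs (fun q => a *: f q + g q) =
  (fun q => a *: hderivs vs f q + hderivs vs g q).
Proof.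
elim: vs f g => [//|v vs IH] f g sf sg.
rewrite /hderivs /= {2}/hfield_derive field_derive_comb //.
by apply: IH; exact: smooth_hfield_derive.
Qed.

Lemma hderivs_translate vs a f : smooth_fun A f ->
  hderivs vs (f \o (fun x => a * x)%g) = hderivs vs f \o (fun x => a * x)%g.
Proof.
elim: vs f => [//|v vs IH] f sf.
rewrite /hderivs /= {2}/hfield_derive field_derive_translate //.
by apply: IH; exact: smooth_hfield_derive.
Qed.

Lemma hderivs0 vs : hderivs vs (cst 0) = cst 0.
Proof.
have s0 := smooth_map_cst lieA (0 : W).
(* Since [0 = -1 *: 0 + 0], linearity writes [f] as [- f + f]. *)
have := hderivs_comb vs (-1) s0 s0; set f := hderivs _ (cst 0) => fE.
have -> : f = hderivs vs (fun q => -1 *: cst 0 q + cst 0 q).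
  by congr (hderivs vs); apply/funext => q; rewrite /= scaler0 addr0.
by rewrite fE; apply/funext => q; rewrite scaleN1r addNr.
Qed.

Lemma smooth_fun_sum (I : Type) (r : seq I) (c : I -> R) (f : I -> G -> W) :
  (forall i, smooth_fun A (f i)) ->
  smooth_fun A (fun q => \sum_(i <- r) c i *: f i q) /\
  forall vs, hderivs vs (fun q => \sum_(i <- r) c i *: f i q) =
    (fun q => \sum_(i <- r) c i *: hderivs vs (f i) q).
Proof.
move=> sf; elim: r => [|i r [IHs IHd]].
  have -> : (fun q : G => \sum_(i <- [::]) c i *: f i q) = cst 0.
    by apply/funext => q; rewrite big_nil.
  split=> [|vs]; first exact: smooth_map_cst.
  by rewrite hderivs0; apply/funext => q; rewrite big_nil.
have -> : (fun q : G => \sum_(j <- i :: r) c j *: f j q) =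
    (fun q => c i *: f i q + \sum_(j <- r) c j *: f j q).
  by apply/funext => q; rewrite big_cons.
split=> [|vs]; first exact: smooth_fun_comb.
by rewrite hderivs_comb // IHd; apply/funext => q; rewrite big_cons.
Qed.

Lemma hfield_derive_basis v f : hfield_derive v f =
  (fun q => \sum_i coord (vbasis fullv) i v *:
                   hfield_derive (vbasis fullv)`_i f q).
Proof.
apply/funext => q; rewrite {1}(coord_vbasis (memvf v)).
rewrite /hfield_derive /field_derive /left_field /tangent_map.
by rewrite !linear_sum; apply: eq_bigr => i _; rewrite !linearZ.
Qed.

(* The [pts] are the tuples of elements of a basis of [V 1]. *)
Lemma hderiv_finitely_determined k :
  exists (I : finType) (pts : I -> k.-tuple (subvs_of (V 1))),
  forall vs : k.-tuple (subvs_of (V 1)),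
  exists c : I -> R, forall (f : G -> W) p, smooth_fun A f ->
    hderiv A f p vs = \sum_i c i *: hderiv A f p (pts i).
Proof.
elim: k => [|k [I [pts ptsP]]].
  exists 'I_1, (fun=> [tuple]) => vs; exists (fun=> 1) => f p _.
  by rewrite big_ord1 scale1r (tuple0 vs).
pose e := vbasis (fullv : {vspace subvs_of (V 1)}).
pose J := ('I_(\dim (fullv : {vspace subvs_of (V 1)})) * I)%type.
exists J, (fun ij : J => [tuple of e`_ij.1 :: pts ij.2]) => vs.
case/tupleP: vs => v t; have [c cP] := ptsP t.
exists (fun ij : J => coord e ij.1 v * c ij.2) => f p sf.
rewrite -(pair_bigA _ (fun i j => (coord e i v * c j) *:
  hderiv A f p [tuple of e`_i :: pts j])) exchange_big /=.
(* The head is derived first, so the induction hypothesis applies to the smooth function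
   [hfield_derive v f]; only then is [v] expanded in the basis. *)
have -> : hderiv A f p [tuple of v :: t] = hderiv A (hfield_derive v f) p t.
  by [].
rewrite cP; last exact: smooth_hfield_derive.
apply: eq_bigr => j _; rewrite hderivE hfield_derive_basis.
have [_ ->] := smooth_fun_sum (index_enum _) (coord e ^~ v)
  (fun i => smooth_hfield_derive e`_i sf).
by rewrite scaler_sumr; apply: eq_bigr => i _; rewrite scalerA mulrC.
Qed.

Lemma HD0 k : @HD R n G A V W k (fun=> 0).
Proof.
exists (cst 0), 1%g; split; first exact: smooth_map_cst.
by apply/funext => vs; rewrite hderivE hderivs0.
Qed.

(** The two jets may sit at different points; translating both functions brings them to the
    identity, where they can be combined. *)
Lemma HD_comb k a (B C : hmap V W k) : HD A B -> HD A C ->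
  HD A (fun vs => a *: B vs + C vs).
Proof.
move=> [f [p [sf ->]]] [g [q [sg ->]]].
have sfp := smooth_map_translate lieA p sf.
have sgq := smooth_map_translate lieA q sg.
exists (fun x => a *: (f \o (fun x => p * x)%g) x + (g \o (fun x => q * x)%g) x).
exists 1%g; split; first exact: smooth_fun_comb.
apply/funext => vs; rewrite !hderivE hderivs_comb //.
by rewrite !hderivs_translate //= !mulg1.
Qed.

(** Restricted to the finitely many [pts], the derivative lies in the subspace [S] and so agrees
    there with some [C] in [HD]. Both are determined by these values in the same way, hence agree on
    all tuples. *)
Lemma tangent_map_HD k (B : G -> hmap V W k) p x :
  (forall q, HD A (B q)) -> (forall vs, smooth_fun A (fun q => B q vs)) ->
  HD A (fun vs => tangent_map A (vec_atlas W) (fun q => B q vs) p x).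
Proof.
move=> HDB sB; have [I [pts ptsP]] := hderiv_finitely_determined k.
pose S := [set f : I -> W | exists2 C : hmap V W k, HD A C & f = C \o pts].
have dB vs := rep_differentiable p hA (@vec_is_atlas _ W) (sB vs).
have [] := @diff_in_subspace _ _ W I S (fun y i => B (cinv (A p) y) (pts i))
  (cmap (A p) p) x.
- by exists (fun=> 0) => //; exact: HD0.
- move=> a _ _ [C HC ->] [C' HC' ->].
  by exists (fun vs => a *: C vs + C' vs) => //; exact: HD_comb.
- by near=> y; exists (B (cinv (A p) y)).
- by move=> i; exact: dB.
move=> C HC CE; suff -> : (fun vs => tangent_map A (vec_atlas W)
  (fun q => B q vs) p x) = C by [].
(* The coefficients depend on [vs] alone, so the same expansion holds for [C] and for every [B q],
   and can be differentiated in [q]. *)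
have determined (C' : hmap V W k) (c : I -> R) (vs : k.-tuple (subvs_of (V 1))) :
    (forall (f : G -> W) p, smooth_fun A f -> hderiv A f p vs =
       \sum_i c i *: hderiv A f p (pts i)) ->
    HD A C' -> C' vs = \sum_i c i *: C' (pts i).
  by move=> cP [f [q [sf ->]]]; exact: cP.
apply/funext => vs; have [c cP] := ptsP vs.
rewrite (determined _ _ _ cP HC) /tangent_map.
have -> : cmap (vec_atlas W (B p vs)) \o (fun q => B q vs) \o cinv (A p) =
    (fun y => \sum_i c i *: B (cinv (A p) y) (pts i)).
  by apply/funext => y; rewrite /= (determined _ _ _ cP (HDB _)).
have [|_ ->] := @diff_big_sum _ _ _ I (index_enum I)
  (fun i y => c i *: B (cinv (A p) y) (pts i)) (cmap (A p) p).
  by move=> i; apply: (differentiableZ (c i)); exact: dB.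
apply: eq_bigr => i _; have := congr1 (@^~ i) CE; rewrite /= => <-.
by rewrite (diffZ (c i) (dB (pts i))).
Unshelve. all: by end_near. Qed.

End Jets.

(** [hook] inserts its vector in last position, so tuples are decomposed from the end. *)
Lemma tuple_rcons T k (t : k.+1.-tuple T) :
  exists (t' : k.-tuple T) v, t = [tuple of rcons t' v].
Proof.
case: t => t; case/lastP: t => [//|t v] tk.
have tk' : size t == k by rewrite size_rcons in tk.
by exists (Tuple tk'), v; apply: val_inj.
Qed.

(** * The Cartan forms along a section *)

Section Cartan.
Context {R : realType} {n : nat} {G : preTopologicalGroupType}.
Variables (A : atlas 'rV[R]_n G) (s : nat) (V : nat -> {vspace 'rV[R]_n}).

Lemma Pi1_id (v : subvs_of (V 1)) :
  is_stratification A s V -> Pi1 s V (vsval v) = v.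
Proof.
case: s => [[//]|s'] [_ _ dV _ _ _].
rewrite /Pi1 daddv_pi_id ?vsvalK ?subvsP //=; apply/eqP; rewrite -subv0.
(* Directness at the index of [V 1] makes it meet the sum of the other layers trivially; that sum is
   then reindexed from [V 2] on. *)
have /directv_sumP/(_ ord0 isT) dV0 := dV; rewrite -[X in (_ <= X)%VS]dV0.
by rewrite [X in (_ <= _ :&: X)%VS]big_mkcond big_ord_recl /= add0v.
Qed.

Variables (W : finDimNormedModType R) (m : nat) (gamma : G -> G * hmaps V W m).
Hypotheses (lieA : is_lie_group A) (strat : is_stratification A s V).
Hypothesis gamma_section : fst \o gamma = id.

Lemma section_fst p : (gamma p).1 = p.
Proof. by rewrite -[LHS]/((fst \o gamma) p) gamma_section. Qed.

Lemma jet_tangent_map1 p x : (jet_tangent_map A gamma p x).1 = x.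
Proof.
rewrite /jet_tangent_map /= gamma_section tangent_map_id //.
by have [/manifold_atlas] := lieA.
Qed.

(** The differential of a section has the given vector as its component along [G]; translated to the
    identity it is [v], which [Pi1] fixes. *)
Lemma pullback_omegaE (l : 'I_m) p (v : subvs_of (V 1)) vs :
  pullback_omega A s l gamma p (left_field A (vsval v) p) vs =
  hfield_derive A v (fun q => jlow (gamma q).2 vs) p
  - hook v (jhigh (gamma p).2 (l := l)) vs.
Proof.
by rewrite /pullback_omega /omega jet_tangent_map1 section_fst left_fieldK // Pi1_id.
Qed.

End Cartan.

Theorem proposition3p8 (R : realType) (n : nat) (G : preTopologicalGroupType)
    (A : atlas 'rV[R]_n G) (s : nat) (V : nat -> {vspace 'rV[R]_n})
    (hG : is_carnot_group A s V) (W : finDimNormedModType R) (m : nat)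
    (gamma : G -> G * hmaps V W m)
    (gamma_jet : forall p, jet_space A (gamma p))
    (gamma_smooth : jet_smooth A gamma)
    (gamma_section : fst \o gamma = id) :
  let i := exists2 f : G -> W, smooth_fun A f & gamma = jet A V m f in
  let ii := forall (l : 'I_m) (p : G),
    horizontal_bundle A V p `<=` [set x | pullback_omega A s l gamma p x = cst 0] in
  let iii := forall p : G,
    jet_tangent_map A gamma p @` horizontal_bundle A V p
      `<=` cartan_distribution A (gamma p) in
  (i <-> ii) /\ (ii <-> iii).
Proof.
move=> i ii iii; have lieA := carnot_lie hG.
have omegaE := pullback_omegaE lieA (carnot_stratified hG) gamma_section.
have g1 := section_fst gamma_section.
(* Condition (ii) as a system of differential equations: deriving the component of order [l] along
   [v] gives the one of order [l.+1] with [v] in last position. *)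
have iiE : ii <-> forall (l : 'I_m) p v vs,
    hfield_derive A v (fun q => jlow (gamma q).2 vs) p =
    hook v (jhigh (gamma p).2 (l := l)) vs.
  split=> [hii l p v vs|hd l p x [v vV ->]].
    apply: subr0_eq; rewrite -omegaE.
    have -> // : pullback_omega A s l gamma p (left_field A (vsval v) p) = cst 0.
    by apply: hii; exists (vsval v) => //; exact: subvsP.
  by apply/funext => vs; rewrite -(vsprojK vV) omegaE hd subrr.
split; split.
- move=> [f sf gammaE]; apply/iiE => l p v vs.
  by rewrite gammaE /jlow /hook /jhigh /= !hderivE /hderivs /= foldl_rcons.
- move=> /iiE hd; pose f q := (gamma q).2 ord0 [tuple].
  (* The induction is on the value of [j], for all [j] at once, since the type of [vs] depends on
     [j]. *)
  have gammaE k : forall (j : 'I_m.+1) q (vs : j.-tuple (subvs_of (V 1))),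
      nat_of_ord j = k -> (gamma q).2 j vs = hderiv A f q vs.
    elim: k => [|k IH] j q.
      move=> vs j0; have jE : j = ord0 by exact: val_inj.
      by move: vs; rewrite jE => vs; rewrite (tuple0 vs).
    case: (unliftP ord0 j) => [l ->|->] // vs [lk].
    have [vs' [v ->]] := tuple_rcons (vs : l.+1.-tuple _).
    (* The equation exhibits the value at [rcons vs' v] as a derivative along [v] of the lower
       component, which the induction hypothesis identifies as a function of the point. *)
    have := hd l q v vs'; rewrite /hook /jhigh => <-.
    rewrite hderivE /= /hderivs foldl_rcons; congr (hfield_derive A v _ q).
    by apply/funext => q'; rewrite /jlow (IH (widen_ord (leqnSn m) l)).
  exists f; first by case: gamma_smooth => _; apply.
  apply/funext => p; rewrite (surjective_pairing (gamma p)) g1; congr pair.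
  apply: functional_extensionality_dep => j; apply/funext => vs.
  exact: gammaE.
- move=> /iiE hd p _ [_ [v vV ->] <-]; rewrite -(vsprojK vV).
  exists (vsproj (V 1) v); split.
  + by rewrite g1 jet_tangent_map1.
  (* The part of (iii) beyond the equations: derivatives of the components stay in [HD]. *)
  + move=> j; apply: (tangent_map_HD lieA) => [q|vs]; first exact: gamma_jet.
    by case: gamma_smooth => _; apply.
  + by move=> l; apply/funext => vs; rewrite -hd.
- move=> hiii; apply/iiE => l p v vs.
  pose x := left_field A (vsval v) p.
  have [|w [vw _ /(_ l) hl]] := hiii p (jet_tangent_map A gamma p x).
    by exists x => //; exists (vsval v) => //; exact: subvsP.
  (* Translating back to the identity shows that the vector [w] given by the Cartan distribution is
     [v]. *)
  have vE : v = w.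
    apply: val_inj; move: vw; rewrite g1 jet_tangent_map1 // => vw.
    by rewrite /= -(left_fieldK lieA (vsval v) p) -/x vw left_fieldK.
  by rewrite [in RHS]vE -hl.
Qed.
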